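(* For every integer $n\ge 1$, the number $T(2,n)=\dfrac{6\,(2n)!}{n!\,(n+2)!}$ equals the number of ordered pairs $(P,Q)$ of Dyck paths of total semilength $n$ (the semilengths of $P$ and $Q$ sum to $n$) such that $|h(P)-h(Q)|\le 1$.
   Context: Paths use steps $(1,1)$ and $(1,-1)$. The level of a point is its $y$-coordinate. A Dyck path of semilength $n$ is such a path starting at $(0,0)$, ending at $(2n,0)$, and never going below level $0$; the empty path is the Dyck path of semilength $0$. The height $h(P)$ of a path $P$ is the highest level it reaches (the empty path has height $0$). *)

(* Defs.v *)
From mathcomp Require Import all_boot all_order all_algebra.
Set Implicit Arguments.
Unset Strict Implicit.
Unset Printing Implicit Defensive.
Import Order.TTheory GRing.Theory Num.Theory.
Local Open Scope ring_scope.

(* A path starting at (0,0) is its sequence of steps: [true] stands for the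
   step (1,1) and [false] for the step (1,-1). *)
Definition step_dy (s : bool) : int := if s then 1 else -1.

(* y-coordinate of the point of P with x-coordinate i, for i <= size P *)
Definition level (P : seq bool) (i : nat) : int :=
  \sum_(s <- take i P) step_dy s.

Definition semilength (P : seq bool) : nat := (size P)./2.

Definition is_dyck (P : seq bool) : bool :=
  [&& size P == (semilength P).*2,
      level P (size P) == 0
    & [forall i : 'I_(size P).+1, 0 <= level P i]].

(* The initial value 0 of the maximum is harmless, since level P 0 = 0. *)
Definition height (P : seq bool) : int :=
  \big[Num.max/0]_(i < (size P).+1) level P i.

(* The length bound 2n only serves to live in a finite type: it follows from
   the condition on the semilengths, see [dyck_pair_size]. *)
Definition dyck_pairs (n : nat) : {set n.*2.-bseq bool * n.*2.-bseq bool} :=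
  [set PQ : n.*2.-bseq bool * n.*2.-bseq bool |
    [&& is_dyck PQ.1, is_dyck PQ.2,
        (semilength PQ.1 + semilength PQ.2 == n)%N
      & `|height PQ.1 - height PQ.2| <= 1]].

Lemma dyck_pair_size (n : nat) (P Q : seq bool) :
  is_dyck P -> is_dyck Q -> (semilength P + semilength Q = n)%N ->
  (size P <= n.*2)%N /\ (size Q <= n.*2)%N.
Proof.
move=> /and3P[/eqP-> _ _] /and3P[/eqP-> _ _] <-.
by rewrite !leq_double leq_addr leq_addl.
Qed.

(* Main.v *)
(** Let [F_j] be the generating function of the Dyck paths of height at most
  [j], and [C] that of all Dyck paths. First return decompositions give
  [F_(j+1) = 1 + x F_(j+1) F_j] and [C = 1 + x C^2], hence
  [C - F_j = x C F_j (C - F_(j-1))]. From these relations the series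
  [(F_j - F_(j-1)) (F_(j+1) - F_(j-2))], which count the pairs [(P, Q)] with
  [h(P) = j] and [|h(P) - h(Q)| <= 1], have a telescoping sum over [j], equal to
  [4 C - C^2 - 2]. So for [n >= 1] there are [4 C_n - C_(n+1)] pairs.
  Power series are handled as polynomials modulo a power of ['X]; the variable
  ['X] marks steps, so that [x] is ['X^2]. *)
Require Import Defs.
From mathcomp Require Import all_boot all_order all_algebra.
From mathcomp Require Import ring lra zify.
Import Order.TTheory GRing.Theory Num.Theory.
Local Open Scope ring_scope.

(** * Telescoping in a commutative ring *)

(* Used with [B j] the generating function of height at most [j - 2], so that
   [B 0 = B 1 = 0] takes care of the heights [0] and [1]. *)
Lemma telescoping_sum (R : comNzRingType) (x C : R) (B : nat -> R) (M : nat) :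
    B 0 = 0 -> B 1 = 0 -> C = 1 + x * C ^+ 2 ->
    (forall j, B j.+2 = 1 + x * B j.+2 * B j.+1) ->
    (forall j, (M < j)%N -> B j = C) ->
  \sum_(q < M.+2) (B q.+2 - B q.+1) * (B q.+3 - B q) = 4 * C - C ^+ 2 - 2.
Proof.
move=> B0 B1 recC recB BM.
have eqC : x * C ^+ 2 = C - 1 by rewrite [in RHS]recC; ring.
have eqB j : x * B j.+2 * B j.+1 = B j.+2 - 1 by rewrite [in RHS]recB; ring.
pose d j := C - B j.
(* Division is avoided: [B j.+2] is the inverse of [1 - x * B j.+1], so multiplying [d j.+2] by the
   latter isolates [x * C * d j.+1]. *)
have dS j : d j.+2 = x * C * B j.+2 * d j.+1.
  have e1 : d j.+2 * (1 - x * B j.+1) = x * C * d j.+1.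
    by rewrite /d; ring: eqC (eqB j).
  have e2 : 1 = B j.+2 * (1 - x * B j.+1) by ring: (eqB j).
  by rewrite -[LHS]mulr1 e2 mulrCA e1; ring.
pose H q := x * B q.+1 * d q ^+ 2.
have HS q : (d q.+2 - d q.+3) * d q.+1 = H q.+1 - H q.+2.
  have e : C - C * B q.+3 * (x * C) = 1 - x * B q.+3 * x * C ^+ 2 * B q.+2.
    by ring: eqC (eqB q.+1).
  rewrite /H (dS q.+1) (dS q).
  transitivity (x * B q.+2 * d q.+1 ^+ 2 * (C - C * B q.+3 * (x * C))).
    by ring.
  by rewrite e; ring.
(* The summand is [(d q.+1 - d q.+2) * (d q - d q.+3)]. For [q >= 1], rewriting its products
   [d q.+1 * d q.+3] and [d q * d q.+2] by [HS] turns it into [Z q - Z q.+1]. *)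
pose Z q := H q - d q.+1 * d q.+2 + H q.+1.
have partial m :
    \sum_(q < m.+1) (B q.+2 - B q.+1) * (B q.+3 - B q) =
      4 * C - C ^+ 2 - 2 - Z m.+1.
  elim: m => [|m IHm].
    (* The term [q = 0] is computed directly from [B 0 = B 1 = 0]; it supplies the closed form. *)
    have B2 : B 2 = 1 by rewrite recB B1; ring.
    rewrite big_ord_recr big_ord0 /= add0r /Z.
    have -> : H 2 = H 1 - (d 2 - d 3) * d 1 by rewrite HS; ring.
    by rewrite /H /d B0 B1 B2; ring: eqC.
  rewrite big_ord_recr /= IHm /Z.
  have -> : H m.+3 = H m.+2 - (d m.+3 - d m.+4) * d m.+2 by rewrite HS; ring.
  have -> : H m.+2 = H m.+1 - (d m.+2 - d m.+3) * d m.+1 by rewrite HS; ring.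
  by rewrite /d; ring.
(* Beyond [M] all differences [d] vanish, and [Z M.+2] with them. *)
by rewrite partial /Z /H /d !BM ?subrr; [ring | lia ..].
Qed.

(** * Counting paths in a strip *)

(** The start level [k] varies so that counts recurse on the first step. The ceiling [h] is tested
    at up steps only, whence the hypothesis [k <= h] in [stripP]. *)
Fixpoint strip (h k : nat) (s : seq bool) : bool :=
  match s with
  | [::] => k == 0
  | true :: s' => (k < h)%N && strip h k.+1 s'
  | false :: s' => (0 < k)%N && strip h k.-1 s'
  end.

Fixpoint words (l : nat) : seq (seq bool) :=
  if l is l'.+1 then
    [seq true :: s | s <- words l'] ++ [seq false :: s | s <- words l']
  else [:: [::]].

Lemma mem_words l s : (s \in words l) = (size s == l).
Proof.
elim: l s => [|l IHl] [|b s] //=.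
  by rewrite mem_cat; apply/norP; split; apply/mapP; case.
have inj c : injective (cons c : seq bool -> _) by move=> ? ? [].
have neq c : (~~ c :: s \in [seq c :: u | u <- words l]) = false.
  by apply/mapP => -[u _ []]; case: c.
rewrite mem_cat eqSS -IHl; case: b.
  by rewrite (mem_map (inj true)) (neq false) orbF.
by rewrite (mem_map (inj false)) (neq true).
Qed.

Lemma words_uniq l : uniq (words l).
Proof.
elim: l => //= l IHl.
have inj c : injective (cons c : seq bool -> _) by move=> ? ? [].
rewrite cat_uniq !map_inj_uniq // IHl andbT /=.
by apply/hasPn => _ /mapP[s _ ->]; apply/mapP => -[].
Qed.

Definition nstrip (h k l : nat) : nat := count (strip h k) (words l).

Lemma nstrip0 h k : nstrip h k 0 = (k == 0).
Proof. by rewrite /nstrip /= addn0. Qed.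

Lemma count_andb (T : Type) (b : bool) (P : pred T) (r : seq T) :
  count (fun s => b && P s) r = (b * count P r)%N.
Proof. by case: b; rewrite ?mul1n // mul0n count_pred0. Qed.

Lemma nstripS h k l :
  nstrip h k l.+1 = ((k < h) * nstrip h k.+1 l + (0 < k) * nstrip h k.-1 l)%N.
Proof.
by rewrite /nstrip -!count_andb /= count_cat !count_map; congr (_ + _)%N;
  apply: eq_count.
Qed.

(* A path from level [k.+1] to level [0] splits at its first visit to [0]. *)
Lemma nstrip_first_passage h k l : (k <= h)%N ->
  nstrip h.+1 k.+1 l.+1 =
    (\sum_(i < l.+1) nstrip h k i * nstrip h.+1 0 (l - i))%N.
Proof.
elim: l k => [|l IHl] k lekh.
  rewrite big_ord_recl big_ord0 nstripS !nstrip0 /=; lia.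
rewrite nstripS big_ord_recl subn0 nstrip0.
under eq_bigr => i _ do rewrite lift0 subSS nstripS mulnDl -!mulnA.
rewrite big_split /= -!big_distrr /=.
have -> : ((k.+1 < h.+1) * nstrip h.+1 k.+2 l.+1 =
    (k < h) * \sum_(i < l.+1) nstrip h k.+1 i * nstrip h.+1 0 (l - i))%N.
  by rewrite ltnS; case: ltnP => // ltkh; rewrite IHl.
(* For [k = 0] a first down step already reaches level 0 and accounts for the summand [i = 0]. *)
case: k lekh => [|k] lekh; first by rewrite /= !mul1n mul0n addn0 addnC.
by rewrite /= mul0n !mul1n add0n IHl // ltnW.
Qed.

Lemma nstrip_first_return h l :
  nstrip h.+1 0 l.+2 =
    (\sum_(i < l.+1) nstrip h 0 i * nstrip h.+1 0 (l - i))%N.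
Proof. by rewrite nstripS mul1n mul0n addn0 nstrip_first_passage. Qed.

Lemma nstrip_short h k l : (l < k)%N -> nstrip h k l = 0%N.
Proof.
elim: l k => [|l IHl] [|k] // ltlk.
by rewrite nstripS !IHl ?muln0 //; lia.
Qed.

(** Ballot numbers [(k+1)/(i+k+1) * binomial(2i+k, i)], cleared of denominators; [i] counts the up
    steps. Length plus start level never grows when a step is removed, so the hypothesis survives
    the induction and keeps the ceiling out of reach. *)
Lemma nstrip_ballot h k i : (i.*2 + k + k <= h)%N ->
  (nstrip h k (i.*2 + k) * ((i + k).+1`! * i`!) = k.+1 * (i.*2 + k)`!)%N.
Proof.
move El: (i.*2 + k)%N => l; elim: l i k El => [|l IHl] i k El leh.
  have [-> ->] : i = 0%N /\ k = 0%N by lia.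
  by rewrite nstrip0.
rewrite nstripS; have -> : (k < h)%N by lia.
(* For [i = 0] only down steps remain: after an up step the path is too short to come back. *)
case: i El => [|i] El.
  case: k El leh => [|k] El leh; first by lia.
  have ekl : k = l by lia.
  rewrite nstrip_short ?muln0; last by lia.
  have := IHl 0%N k ltac:(lia) ltac:(lia); rewrite ekl.
  rewrite !add0n fact0 !muln1 mul1n /= [l.+2`!]factS mulnCA.
  by move=> ->; rewrite -factS.
have := IHl i k.+1 ltac:(lia) ltac:(lia).
rewrite addnS addSn (factS i) (factS l).
case: k El leh => [|k] El leh.
  rewrite !mul0n !mul1n !addn0. have -> : l = (i.*2).+1 by lia. nia.
have := IHl i.+1 k ltac:(lia) ltac:(lia).
rewrite addSn addnS (factS i) (factS (i + k).+2) /= !mul1n.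
move: (nstrip _ _ _) (nstrip _ _ _) (i + k).+2`! i`! l`! => b a u v w e2 e1.
have -> : l = (i.*2 + k.+1)%N.+1 by lia.
nia.
Qed.

Lemma nstrip_stable h k l : (k + l <= h)%N -> nstrip h.+1 k l = nstrip h k l.
Proof.
elim: l k => [|l IHl] k leh; first by rewrite !nstrip0.
rewrite !nstripS ltnS; have [-> ->] : (k < h)%N /\ (k <= h)%N by lia.
by rewrite !IHl //; lia.
Qed.

(** * Levels and heights of Dyck paths *)

Lemma level_nil i : level [::] i = 0.
Proof. by rewrite /level big_nil. Qed.

Lemma level0 s : level s 0 = 0.
Proof. by rewrite /level take0 big_nil. Qed.

Lemma level_cons b s i : level (b :: s) i.+1 = step_dy b + level s i.
Proof. by rewrite /level /= big_cons. Qed.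

Lemma stripP h k s : (k <= h)%N ->
  reflect (k%:Z + level s (size s) = 0 /\
           forall i, (i <= size s)%N -> 0 <= k%:Z + level s i <= h%:Z)
          (strip h k s).
Proof.
elim: s k => [|b s IHs] k lekh /=.
  apply: (iffP eqP) => [->|[]]; last by rewrite level_nil addr0 => -[].
  by split=> [|i _]; rewrite level_nil addr0.
have cons_levels k' : k%:Z + step_dy b = k'%:Z -> (k' <= h)%N ->
    reflect (k%:Z + level (b :: s) (size s).+1 = 0 /\
       forall i, (i <= (size s).+1)%N -> 0 <= k%:Z + level (b :: s) i <= h%:Z)
      (strip h k' s).
  move=> ek' lek'h; apply: (iffP (IHs _ lek'h)).
    rewrite level_cons addrA ek' => -[-> bnd]; split=> // -[|i] lei.
      by rewrite level0; lia.
    by rewrite level_cons addrA ek' bnd.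
  rewrite level_cons addrA ek' => -[-> bnd]; split=> // i lei.
  by rewrite -ek' -addrA -level_cons bnd.
case: b cons_levels => cons_levels.
  case: ltnP => [ltkh|lehk] /=; first by apply: cons_levels => //=; lia.
  apply: ReflectF => -[_ /(_ 1%N isT)].
  by rewrite level_cons level0 /=; lia.
case: k lekh cons_levels => [|k] lekh cons_levels /=.
  apply: ReflectF => -[_ /(_ 1%N isT)].
  by rewrite level_cons level0 /=.
by apply: cons_levels => /=; lia.
Qed.

Lemma odd_strip h k s : strip h k s -> odd (size s) = odd k.
Proof.
elim: s k => [k /eqP -> //|b s IHs] k /=.
case: b => /andP[lt_k /IHs ->] /=; first by rewrite negbK.
by case: k lt_k.
Qed.

Lemma strip_wide h h' k s :
  strip h k s -> (k + size s <= h')%N -> strip h' k s.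
Proof.
elim: s k => //= -[] s IHs k /andP[lt_k /IHs strip_s] le_h'.
  by rewrite strip_s ?andbT; lia.
by rewrite lt_k strip_s //; lia.
Qed.

Lemma height_ge0 s : 0 <= height s.
Proof. by rewrite /height; apply: bigmax_ge_id. Qed.

Lemma strip_dyck h s : strip h 0 s = is_dyck s && (`|height s| <= h)%N.
Proof.
have -> : (`|height s| <= h)%N = (height s <= h%:Z).
  by have := height_ge0 s; lia.
apply/stripP/andP => // [[]|[/and3P[_ /eqP lvl0 /forallP lvl_ge0] le_h]].
  rewrite add0r => lvl0 bnd; split; last first.
    apply/bigmax_leP; split=> // i _.
    by have /andP[] := bnd i (ltnSE (ltn_ord i)); rewrite add0r.
  have s_strip : strip h 0 s by apply/stripP; rewrite ?add0r.
  (* Each step changes the parity of the level, so a return to level 0 has even length. *)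
  have evs : ~~ odd (size s) by rewrite (odd_strip h 0).
  rewrite /is_dyck lvl0 /semilength (even_halfK evs) !eqxx /=.
  apply/forallP => i.
  by have /andP[] := bnd i (ltnSE (ltn_ord i)); rewrite add0r.
split=> [|i lei]; first by rewrite add0r.
have lti : (i < (size s).+1)%N by [].
rewrite add0r (lvl_ge0 (Ordinal lti)) /=.
by case/bigmax_leP: le_h => _ /(_ (Ordinal lti) isT).
Qed.

Lemma height_le_size s : is_dyck s -> (`|height s| <= size s)%N.
Proof.
move=> s_dyck.
have : strip `|height s| 0 s by rewrite strip_dyck s_dyck leqnn.
by move=> /(strip_wide _ (size s))/(_ (leqnn _)); rewrite strip_dyck => /andP[].
Qed.

(** * Truncated generating functions by height *)

Lemma big_bseq_words (V : nmodType) (K : nat) (F : seq bool -> V) :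
  \sum_(s : K.-bseq bool) F s = \sum_(l < K.+1) \sum_(s <- words l) F s.
Proof.
rewrite -(big_mkord xpredT (fun l => \sum_(s <- words l) F s)).
rewrite -(big_map words xpredT (fun r => \sum_(s <- r) F s)) -big_flatten.
rewrite -(big_map (fun s : K.-bseq bool => val s) xpredT F).
apply: perm_big; apply: uniq_perm.
- by rewrite map_inj_uniq ?index_enum_uniq //; apply: val_inj.
- rewrite /index_iota subn0; elim: K.+1 0%N => // m IHm i /=.
  rewrite cat_uniq words_uniq IHm andbT /=; apply/hasPn => s /flatten_mapP[l].
  by rewrite mem_iota !mem_words => + /eqP ->; lia.
move=> s; apply/mapP/flatten_mapP => [[t _ ->]|[l]].
  exists (size t); last by rewrite mem_words.
  by rewrite mem_index_iota ltnS size_bseq.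
rewrite mem_index_iota ltnS mem_words => lel /eqP sl.
have lesK : (size s <= K)%N by rewrite sl.
by exists (Bseq lesK); rewrite ?mem_index_enum.
Qed.

(** Reduction modulo ['X^(m.+1)] is a ring morphism, so identities between series can be proved in
    the quotient ring. *)
Definition trunc (R : comNzRingType) (m : nat) :
    {rmorphism {poly R} -> {poly %/ ('X^(m.+1) : {poly R})}} :=
  in_qpoly ('X^(m.+1)).

Lemma truncP (R : comNzRingType) (m : nat) (p q : {poly R}) :
  trunc R m p = trunc R m q <->
  forall i, (i <= m)%N -> p`_i = q`_i.
Proof.
have valE (r : {poly R}) :
    trunc R m r = take_poly m.+1 r :> {poly R}.
  by rewrite /= mk_monic_Xn -Pdiv.RingMonic.take_poly_rmodp.
split=> [/(congr1 (@polyn _ _)) | eqpq].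
  rewrite !valE => /polyP eqpq i lei.
  by have := eqpq i; rewrite !coef_take_poly ltnS lei.
apply: val_inj; apply/polyP => i.
rewrite -[LHS]/((trunc R m p : {poly R})`_i).
rewrite -[RHS]/((trunc R m q : {poly R})`_i).
by rewrite !valE !coef_take_poly ltnS; case: leqP => // /eqpq.
Qed.

(* The shift by 2 makes [low_dyck 0] and [low_dyck 1] empty, which absorbs the
   boundary terms of the sum over heights. *)
Definition low_dyck (j : nat) (s : seq bool) : bool :=
  is_dyck s && (`|height s|.+1 < j)%N.

Definition low_gf (K j : nat) : {poly rat} :=
  \poly_(l < K.+1) (count (low_dyck j) (words l))%:R.

Lemma low_dyck_strip j s : low_dyck j.+2 s = strip j 0 s.
Proof. by rewrite strip_dyck /low_dyck !ltnS. Qed.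

Lemma coef_low_gf K j l : (l <= K)%N -> (low_gf K j.+2)`_l = (nstrip j 0 l)%:R.
Proof.
move=> lel; rewrite coef_poly ltnS lel /nstrip.
by rewrite (eq_count (low_dyck_strip j)).
Qed.

Lemma low_gf_eq0 K j : (j < 2)%N -> low_gf K j = 0.
Proof.
move=> ltj2; apply/polyP=> l; rewrite coef_poly coef0 (eq_count (a2 := pred0)).
  by rewrite count_pred0 if_same.
by move=> s; rewrite /low_dyck ltnNge (leq_trans (ltnSE ltj2)) ?andbF.
Qed.

Lemma nstrip_widen h h' l : (l <= h <= h')%N -> nstrip h' 0 l = nstrip h 0 l.
Proof.
case/andP=> lel /subnKC <-.
elim: (h' - h)%N => [|d IHd]; first by rewrite addn0.
by rewrite addnS nstrip_stable ?IHd //; lia.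
Qed.

(** A path with at most [K] steps has height at most [K], so larger bounds exclude nothing. *)
Lemma low_gf_stable K j : (K.+1 < j)%N -> low_gf K j = low_gf K K.+2.
Proof.
case: j => [|[|j]] // leKj; apply/polyP => l.
have [lel|ltl] := leqP l K; last by rewrite !coef_poly ltnS leqNgt ltl.
by rewrite !coef_low_gf // (nstrip_widen K) //; lia.
Qed.

(** First return decomposition; ['X^2] stands for the first step and the returning step. Cutting the
    series at degree [K] leaves the equation valid only up to that degree. *)
Lemma low_gf_rec K j :
  trunc rat K (low_gf K j.+2) =
  trunc rat K (1 + 'X^2 * low_gf K j.+2 * low_gf K j.+1).
Proof.
apply/truncP => i lei; rewrite -mulrA coefD coef1 coefXnM coef_low_gf //.
case: i lei => [|[|i]] lei /=; first by rewrite nstrip0 addr0.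
  by rewrite nstripS nstrip0 muln0 mul0n addr0.
rewrite add0r subn2 /=.
(* Height bound 0 allows only the empty path, in agreement with [low_gf K 1 = 0]. *)
case: j => [|j].
  by rewrite (low_gf_eq0 K 1) // mulr0 coef0 nstripS.
rewrite nstrip_first_return natr_sum mulrC coefM; apply: eq_bigr => k _.
by rewrite natrM !coef_low_gf //; have := ltn_ord k; lia.
Qed.

Lemma low_gfE K j : low_gf K j =
  \sum_(s : K.-bseq bool) (low_dyck j s)%:R *: 'X^(size s).
Proof.
rewrite (big_bseq_words _ _ (fun s => (low_dyck j s)%:R *: 'X^(size s))).
rewrite /low_gf poly_def; apply: eq_bigr => l _.
rewrite -sum1_count natr_sum scaler_suml big_mkcond /= !big_seq.
apply: eq_bigr => s; rewrite mem_words => /eqP ->.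
by case: low_dyck; rewrite ?scale0r.
Qed.

(** * Counting pairs of close heights *)

(** For Dyck paths, the first factor is the indicator of [h(s) = q] and the second that of
    [q - 1 <= h(t) <= q + 1], so only the index [q = h(s)] contributes; it is in range since heights
    are at most sizes. *)
Lemma sum_close_heights (M : nat) (s t : seq bool) : (size s < M)%N ->
  \sum_(q < M) ((low_dyck q.+2 s)%:R - (low_dyck q.+1 s)%:R) *
     ((low_dyck q.+3 t)%:R - (low_dyck q t)%:R) =
  [&& is_dyck s, is_dyck t & `|height s - height t| <= 1]%:R :> rat.
Proof.
move=> ltsM; rewrite /low_dyck.
have [s_dyck|_] := boolP (is_dyck s); last first.
  by rewrite big1 // => q _; rewrite subrr mul0r.
have [t_dyck|_] := boolP (is_dyck t); last first.
  by rewrite big1 // => q _; rewrite subrr mulr0.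
have lthM := leq_ltn_trans (height_le_size s s_dyck) ltsM.
rewrite (bigD1 (Ordinal lthM)) //= big1 => [|q neq_q].
  rewrite addr0 ltnS leqnn ltnn subr0 mul1r.
  have := height_ge0 s; have := height_ge0 t.
  move: (height s) (height t) => a b b0 a0.
  have [le_ab|gt_ab] := leP `|a - b| 1.
    have -> : (`|b|.+1 < `|a|.+3)%N by lia.
    have -> : (`|b|.+1 < `|a|)%N = false by lia.
    by rewrite subr0.
  have [lt_ba|le_ab] := ltnP `|b|.+1 `|a|.
    have -> : (`|b|.+1 < `|a|.+3)%N by lia.
    by rewrite subrr.
  have -> : (`|b|.+1 < `|a|.+3)%N = false by lia.
  by rewrite subrr.
have {}neq_q : (q : nat) <> `|height s|%N.
  by move=> eq_q; case/eqP: neq_q; apply: val_inj.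
have -> : (`|height s|.+1 < q.+2)%N = (`|height s|.+1 < q.+1)%N by lia.
by rewrite subrr mul0r.
Qed.

(** Expanding the products gives a sum over pairs weighted by ['X^(size s + size t)]. Summing over
    [q] first leaves the indicator of close heights, and degree [2n] selects total semilength
    [n]. *)
Lemma card_dyck_pairs (n M : nat) : (n.*2 < M)%N ->
  #|dyck_pairs n|%:R =
  (\sum_(q < M) (low_gf n.*2 q.+2 - low_gf n.*2 q.+1) *
                (low_gf n.*2 q.+3 - low_gf n.*2 q))`_n.*2.
Proof.
move=> ltM.
have subE i j : low_gf n.*2 i - low_gf n.*2 j = \sum_(s : n.*2.-bseq bool)
    ((low_dyck i s)%:R - (low_dyck j s)%:R) *: 'X^(size s).
  rewrite !low_gfE -sumrB; apply: eq_bigr => s _; by rewrite scalerBl.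
under eq_bigr => q _ do rewrite !subE big_distrlr /=.
rewrite exchange_big /=.
under eq_bigr => s _ do rewrite exchange_big /=.
rewrite pair_big /= coef_sum -sum1_card natr_sum big_mkcond /=.
apply: eq_bigr => -[s t] _; rewrite inE /=.
under eq_bigr => q _ do rewrite -scalerAl -scalerAr -exprD scalerA.
rewrite -scaler_suml coefZ coefXn sum_close_heights; last first.
  by rewrite (leq_ltn_trans (size_bseq s)).
have [s_dyck|] := boolP (is_dyck s); last by rewrite mul0r.
have [t_dyck|] := boolP (is_dyck t); last by rewrite mul0r.
have /and3P[/eqP -> _ _] := s_dyck; have /and3P[/eqP -> _ _] := t_dyck.
rewrite -doubleD (inj_eq double_inj) eq_sym /=.
by case: eqP; case: (_ <= _); rewrite ?mulr0 ?mulr1.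
Qed.

Lemma dyck_pairs_catalan (n : nat) : (0 < n)%N ->
  #|dyck_pairs n|%:R =
    4 * (nstrip n.*2.+3 0 n.*2)%:R - (nstrip n.*2.+3 0 n.*2.+2)%:R :> rat.
Proof.
move=> n_gt0; set K := n.*2.
have leM : (K < K.+4)%N by lia.
rewrite (card_dyck_pairs n K.+4) //; set S := \sum_(q < _) _.
pose C := low_gf K K.+4.
have : trunc rat K S = trunc rat K (4 * C - C ^+ 2 - 2).
  rewrite /S !(rmorphB, rmorph_sum, rmorphM, rmorphXn, rmorph_nat) /=.
  under eq_bigr => q _ do rewrite rmorphM !rmorphB /=.
  apply: (telescoping_sum _ (trunc rat K 'X^2) _
    (fun j => trunc rat K (low_gf K j)) K.+2).
  - by rewrite low_gf_eq0 ?rmorph0.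
  - by rewrite low_gf_eq0 ?rmorph0.
  (* Both height bounds in this instance exceed [K.+1], so the recursion becomes the quadratic
     equation for [C]. *)
  - have := low_gf_rec K K.+3.
    rewrite low_gf_stable; last by lia.
    rewrite -(low_gf_stable K K.+4); last by lia.
    by rewrite rmorphD !rmorphM rmorph1 -mulrA.
  - by move=> j; rewrite [LHS]low_gf_rec rmorphD !rmorphM rmorph1.
  - move=> j ltj.
    by rewrite /C (low_gf_stable K j) ?(low_gf_stable K K.+4) //; lia.
move=> /truncP -> //.
have K0 : (K == 0)%N = false by lia.
rewrite !coefB (coefMn 1) coef1 K0 mul0rn.
have -> : (4 * C)`_K = 4 * C`_K by rewrite mulr_natl coefMn mulr_natl.
(* By first return, the coefficient of [C ^+ 2] is the Catalan number of index [n + 1]; the ceilings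
   [K.+2] and [K.+3] are equivalent for lengths up to [K]. *)
rewrite subr0 coef_low_gf // expr2 coefM nstrip_first_return natr_sum.
rewrite (nstrip_widen K.+2 K.+3 K); last by lia.
apply: (congr1 (fun u => _ - u)).
apply: eq_bigr => i _; have lei : (i <= K)%N by have := ltn_ord i; lia.
rewrite (nstrip_widen K.+2 K.+3 (K - i)); last by lia.
rewrite natrM /C (coef_low_gf _ _ _ lei).
by rewrite (coef_low_gf _ _ _ (leq_subr i K)).
Qed.

Theorem theorem2p2 (n : nat) (hn : (1 <= n)%N) :
  (6 * (n.*2)`!%:R) / (n`!%:R * (n.+2)`!%:R) = #|dyck_pairs n|%:R :> rat.
Proof.
rewrite dyck_pairs_catalan //.
(* At [k = 0] the ballot numbers are the Catalan numbers of index [n] and [n + 1]; the rest is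
   rational arithmetic. *)
have := nstrip_ballot n.*2.+3 0 n; have := nstrip_ballot n.*2.+3 0 n.+1.
rewrite !addn0 doubleS !mul1n => /(_ ltac:(lia)) e2 /(_ ltac:(lia)) e1.
move: (nstrip _ _ _) (nstrip _ _ _) e1 e2 => a b.
rewrite !factS.
move=> /(congr1 (fun m => m%:R : rat)) + /(congr1 (fun m => m%:R : rat)).
rewrite !natrM.
have f0 m : m`!%:R != 0 :> rat by rewrite pnatr_eq0 -lt0n fact_gt0.
move: (f0 n) (f0 n.*2).
move: (n`!)%:R (n.*2`!)%:R => u v u0 v0 e1 e2.
have eN : n.*2%:R = 2 * n%:R :> rat by rewrite -muln2 natrM mulrC.
move: e1 e2; rewrite -![_.+2%:R]natr1 -![_.+1%:R]natr1 eN => e1 e2.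
have n_ge0 : 0 <= n%:R :> rat by [].
move: (n%:R : rat) n_ge0 e1 e2 => x x_ge0 e1 e2.
have x1 : x + 1 != 0 by lra.
have x2 : x + 1 + 1 != 0 by lra.
have -> : b%:R = v / ((x + 1) * u * u) by rewrite -e1; field; rewrite x1 u0.
have -> : a%:R = (2 * x + 1 + 1) * ((2 * x + 1) * v) /
    ((x + 1 + 1) * ((x + 1) * u) * ((x + 1) * u)).
  by rewrite -e2; field; rewrite x1 x2 u0.
by field; rewrite x1 x2 u0.
Qed.
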